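(* Let $p\in[1,+\infty]$ with conjugate exponent $q$, let $m\in\mathcal P_p(\mathbb R)$ and $\mathcal X=\mathrm{supp}(m)$. Let $R\subset\mathcal P_q(\mathbb R)$ be nonempty, bounded (i.e. $\sup_{r\in R}\mathcal M_q(r)<+\infty$), convex and closed for the weak-$^*$ topology, and assume that $\mathcal Y_R=\bigcup_{r\in R}\mathrm{supp}(r)\subset\mathbb R_+$ is a finite set. Then both problems $$\inf_{(f,g)\in K}\mathcal J(f,g)\qquad\text{and}\qquad\inf_{g\in\mathcal C_q^0(\mathcal Y_R)}\tilde{\mathcal J}(g)$$ have a solution (i.e. both infima are attained).
   Context: The conjugate exponent $q$ of $p$ satisfies $1/p+1/q=1$ ($q=+\infty$ if $p=1$, $q=1$ if $p=+\infty$), and $\mathbb R_+=[0,+\infty)$. For a Borel probability measure $m$ on $\mathbb R$, $\mathcal M_s(m)=\big(\int|x|^s\,\mathrm dm(x)\big)^{1/s}$ if $s<+\infty$ and $\mathcal M_\infty(m)=\sup_{x\in\mathrm{supp}(m)}|x|$; $\mathcal P_s(\mathbb R)$ is the set of Borel probability measures on $\mathbb R$ with $\mathcal M_s(m)<+\infty$. For $\mathcal Z\subset\mathbb R$, $\mathcal C_s^0(\mathcal Z)$ is the space of continuous $f:\mathcal Z\to\mathbb R$ with $\|f\|_s=\sup_{x\in\mathcal Z}\frac{|f(x)|}{1+|x|^s}<+\infty$ if $s<+\infty$, and the space of bounded continuous functions with the supremum norm if $s=+\infty$. Elements of $\mathcal P_q(\mathbb R)$ are seen as elements of the topological dual $\mathcal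 C_q^0(\mathbb R)^*$ through $\langle r,g\rangle=\int g\,\mathrm dr$, and ''closed for the weak-$^*$ topology'' means weakly-$^*$ closed in $\mathcal C_q^0(\mathbb R)^*$. For $g\in\mathcal C_q^0(\mathcal Y_R)$: $\sigma_R(g)=\sup_{r\in R}\int_{\mathcal Y_R}g\,\mathrm dr$, and $g^*(x)=\sup_{y\in\mathcal Y_R}\{xy-g(y)\}$ for $x\in\mathcal X$. The set $K$ consists of all $(f,g)\in\mathcal C_p^0(\mathcal X)\times\mathcal C_q^0(\mathcal Y_R)$ such that $xy\le f(x)+g(y)$ for all $(x,y)\in\mathcal X\times\mathcal Y_R$. Finally, $$\mathcal J(f,g)=\int_{\mathcal X}f\,\mathrm dm+\sigma_R(g),\qquad\tilde{\mathcal J}(g)=\int_{\mathcal X}g^*\,\mathrm dm+\sigma_R(g).$$ *)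

(* Defs.v *)
From HB Require Import structures.
From mathcomp Require Import all_boot all_order all_algebra.
From mathcomp Require Import all_classical all_reals all_analysis.

Set Implicit Arguments.
Unset Strict Implicit.
Unset Printing Implicit Defensive.

Import Order.TTheory GRing.Theory Num.Theory.
Import numFieldNormedType.Exports.

Local Open Scope classical_set_scope.
Local Open Scope ring_scope.

Section measures.
Context {R : realType}.
Implicit Types (m r : probability R R) (s : \bar R) (A : set (probability R R)).

Definition supp m : set R :=
  [set x | forall U : set R, open U -> U x -> (0 < m U)%E].

(* The value at s = -oo is junk; exponents range over [1, +oo]. *)
Definition moment s m : \bar R :=
  match s with
  | s%:E => ((\int[m]_x (`|x| `^ s)%:E) `^ s^-1)%E
  | +oo%E => ereal_sup [set `|x|%:E | x in supp m]
  | -oo%E => +oo%E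
  end.

Definition finite_moment s : set (probability R R) :=
  [set m | moment s m < +oo]%E.

(* Two measures of type [probability R R] agreeing on Borel sets need not be
   equal as terms, hence the existential: the mixture belongs to [A] up to its
   values on nonmeasurable sets. *)
Definition convex_measures A : Prop :=
  forall r1 r2 (t : R), A r1 -> A r2 -> 0 <= t <= 1 ->
  exists2 r, A r &
    forall B : set R, measurable B ->
      (r B = t%:E * r1 B + (1 - t)%:E * r2 B)%E.

Definition supports A : set R := \bigcup_(r in A) supp r.

End measures.

Section weighted_continuous.
Context {R : realType}.
Implicit Types (s : \bar R) (Z : set R) (f g : R -> R).

Definition weight s (x : R) : R :=
  if s is s%:E then 1 + `|x| `^ s else 1.

Definition C0norm s Z f : \bar R :=
  ereal_sup [set (`|f x| / weight s x)%:E | x in Z].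

(* A function on Z is represented by a function on the whole line; only its
   values on Z matter. *)
Definition C0 s Z : set (R -> R) :=
  [set f | {within Z, continuous f} /\ (C0norm s Z f < +oo)%E].

Lemma weight_gt0 s x : 0 < weight s x.
Proof. by case: s => [s| |] //=; rewrite ltr_wpDr// powR_ge0. Qed.

Lemma C0normP s Z f (M : R) :
  (C0norm s Z f <= M%:E)%E <-> forall x, Z x -> `|f x| <= M * weight s x.
Proof.
split=> [fM x Zx|fM].
  rewrite -ler_pdivrMr ?weight_gt0// -lee_fin (le_trans _ fM)//.
  by apply: ereal_sup_ubound; exists x.
apply: ge_ereal_sup => _ [x Zx <-].
by rewrite lee_fin ler_pdivrMr ?weight_gt0//; exact: fM.
Qed.

Lemma C0norm_lty s Z f : (C0norm s Z f < +oo)%E <->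
  exists M, forall x, Z x -> `|f x| <= M * weight s x.
Proof.
split=> [|[M /C0normP fM]]; last exact: le_lt_trans fM (ltry _).
case E : (C0norm s Z f) => [M| |] // _.
  by exists M; apply/C0normP; rewrite E.
by exists 0; apply/C0normP; rewrite E leNye.
Qed.

Lemma C0_submod_closed s Z : submod_closed (mem (C0 s Z) : {pred R -> R}).
Proof.
split=> [|a f g].
  rewrite !inE; split; first by move=> x; exact: cst_continuous.
  by apply/C0norm_lty; exists 0 => x _; rewrite normr0 mul0r.
rewrite !inE => -[cf /C0norm_lty[M fM]] [cg /C0norm_lty[N gN]]; split.
  move=> x; apply: (@continuousD R R (subspace Z) (a *: f) g); last exact: cg.
  by apply: (@continuousM R (subspace Z) (cst a) f); [exact: cst_continuous|exact: cf].
apply/C0norm_lty; exists (`|a| * M + N) => x Zx.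
rewrite (le_trans (ler_normD _ _))// mulrDl -mulrA lerD ?gN//.
by rewrite normrM ler_wpM2l// fM.
Qed.

End weighted_continuous.

Section C0T.
Context {R : realType}.

Record C0T (s : \bar R) := MkC0T {
  C0T_fun :> R -> R;
  C0T_mem : C0T_fun \in C0 s setT
}.

Context (s : \bar R).

HB.instance Definition _ := [isSub for @C0T_fun s].
HB.instance Definition _ := [Choice of C0T s by <:].
HB.instance Definition _ := GRing.isSubmodClosed.Build R (R -> R)
  (mem (C0 s setT) : {pred R -> R}) (@C0_submod_closed R s setT).
HB.instance Definition _ := [SubChoice_isSubLmodule of C0T s by <:].

End C0T.

Section C0_norm.
Context {R : realType} (s : \bar R).
Implicit Types f g : C0T s.

Definition C0T_norm f : R := fine (C0norm s setT f).

Lemma C0T_normE f : (C0T_norm f)%:E = C0norm s setT f.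
Proof.
rewrite /C0T_norm fineK// fin_numElt; apply/andP; split; last first.
  by have := C0T_mem f; rewrite inE => -[].
apply: (@lt_le_trans _ _ (`|f 0| / weight s 0)%:E); first exact: ltNyr.
by apply: ereal_sup_ubound; exists 0.
Qed.

Lemma C0T_normP f (M : R) :
  (C0T_norm f <= M) <-> forall x, `|f x| <= M * weight s x.
Proof.
rewrite -lee_fin C0T_normE; split; first by move=> /C0normP + x; apply.
by move=> fM; apply/C0normP => x _; exact: fM.
Qed.

Lemma C0T_norm_ubound f x : `|f x| <= C0T_norm f * weight s x.
Proof. exact: (C0T_normP f _).1. Qed.

Lemma C0T_norm_ge0 f : 0 <= C0T_norm f.
Proof.
rewrite -(pmulr_lge0 _ (weight_gt0 s 0)).
exact: le_trans (C0T_norm_ubound f 0).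
Qed.

Lemma C0T_ler_normD f g : C0T_norm (f + g) <= C0T_norm f + C0T_norm g.
Proof.
apply/C0T_normP => x; rewrite mulrDl (le_trans (ler_normD _ _))//.
by rewrite lerD// C0T_norm_ubound.
Qed.

Let normZ_le (a : R) f : C0T_norm (a *: f) <= `|a| * C0T_norm f.
Proof.
apply/C0T_normP => x; rewrite -mulrA [X in X <= _]normrM.
by rewrite ler_wpM2l// C0T_norm_ubound.
Qed.

Lemma C0T_normZ (a : R) f : C0T_norm (a *: f) = `|a| * C0T_norm f.
Proof.
apply/eqP; rewrite eq_le normZ_le /=.
have [->|a0] := eqVneq a 0; first by rewrite normr0 mul0r C0T_norm_ge0.
rewrite -ler_pdivlMl ?normr_gt0// -normfV.
by rewrite -[in leLHS](scalerK a0 f) normZ_le.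
Qed.

Lemma C0T_norm0_eq0 f : C0T_norm f = 0 -> f = 0.
Proof.
move=> f0; apply/val_inj/funext => x; apply/eqP.
by rewrite -normr_le0 (le_trans (C0T_norm_ubound f x))// f0 mul0r.
Qed.

HB.instance Definition _ := Lmodule_isNormed.Build R (C0T s)
  C0T_ler_normD C0T_normZ C0T_norm0_eq0.

End C0_norm.

(* The topology is that of [set_type]: induced on the dual by the topology of
   pointwise convergence on [E -> R]. *)
Definition weak_star_dual {R : realType} (E : normedModType R) : topologicalType :=
  [set L : {ptws E -> R^o} | linear (L : E -> R^o) /\ continuous (L : E -> R^o)].

Section problem.
Context {R : realType}.
Implicit Types (m r : probability R R) (A : set (probability R R)).
Implicit Types (p q : \bar R) (f g : R -> R) (X Y : set R).

(* The elements of [A], viewed as functionals on the space of continuous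
   functions on the line with growth of order q. *)
Definition as_functionals q A : set (weak_star_dual (C0T q)) :=
  [set L | exists2 r, A r &
    forall g : C0T q, (val L g)%:E = (\int[r]_y (g y)%:E)%E].

Definition weak_star_closed q A : Prop := closed (as_functionals (q := q) A).

Definition sigma A g : \bar R :=
  ereal_sup [set (\int[r]_(y in supports A) (g y)%:E)%E | r in A].

Definition conjugate Y g (x : R) : \bar R :=
  ereal_sup [set (x * y - g y)%:E | y in Y].

Definition K p q X Y : set ((R -> R) * (R -> R)) :=
  [set fg | [/\ C0 p X fg.1, C0 q Y fg.2 &
    forall x y, X x -> Y y -> x * y <= fg.1 x + fg.2 y]].

Definition J m A (fg : (R -> R) * (R -> R)) : \bar R :=
  (\int[m]_(x in supp m) (fg.1 x)%:E + sigma A fg.2)%E.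

Definition Jtilde m A g : \bar R :=
  (\int[m]_(x in supp m) conjugate (supports A) g x + sigma A g)%E.

End problem.

Definition inf_attained {R : realType} {T : Type} (S : set T) (F : T -> \bar R) :=
  exists2 u, S u & F u = ereal_inf (F @` S).

(* Main.v *)
Require Import Defs.
From mathcomp Require Import all_boot all_order all_algebra.
From mathcomp Require Import all_classical all_reals all_analysis.
From mathcomp Require Import measurable_realfun.
From mathcomp Require Import lra.
Import Order.TTheory GRing.Theory Num.Theory.
Import numFieldNormedType.Exports.
Local Open Scope classical_set_scope.
Local Open Scope ring_scope.

(** Write Y for the finite set [supports A] and X for [supp m].  On Y
    every function is continuous with finite weighted norm, so the second
    problem minimises Jtilde over the finite-dimensional space of functions on
    Y.  There the direct method applies.
    - Jtilde is finite and continuous.  Both g |-> -g^* and sigma are monotone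
      and commute with the addition of constants, so a perturbation of g by at
      most e in sup norm on Y changes Jtilde(g) by at most 2e
      ([Jtilde_shift]).  The same estimate shows that Jtilde is invariant under
      g |-> g + c: the integral of g^* against the probability m loses c, and
      sigma(g) gains it.  Hence one may assume that the minimum of g on Y is 0.
    - Jtilde is coercive on such g.  If g(z) = 0, then g^*(x) >= x z, so the
      integral of g^* is bounded below by a constant, because m has a finite
      first moment ([conjugate_integral_lbound]).  Each y in Y is an atom of
      some r in A, because supp r is finite, and then
      sigma(g) >= r{y} g(y) ([sigma_ge_atom]).
    So the infimum may be taken over a box of functions, which is compact by
    Tychonoff's theorem ([finite_coercive_attained]).

    The first problem reduces to the second.  The constraint defining [K] says
    that f >= g^* on X, so J(f, g) >= Jtilde(g) ([Jtilde_le_J]), with equality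
    for f = g^*.  The function g^* is Lipschitz, and |x| is dominated by the
    weight of order p on X, so the pair (g^*, g) is admissible
    ([rconjugate_K]). *)

(** * Supports of probability measures on the line *)

Section support.
Context {R : realType}.
Implicit Types (mu : probability R R).

Lemma finite_closed {X : set R} : finite_set X -> closed X.
Proof.
move: X; apply/accessible_finite_set_closed.
exact/hausdorff_accessible/Rhausdorff.
Qed.

Lemma supp_closed mu : closed (supp mu).
Proof.
rewrite -openC openE => x /= /existsNP[U /not_implyP[oU /not_implyP[Ux U0]]].
apply: (filterS _ (open_nbhs_nbhs (conj oU Ux))) => z Uz /= /(_ U oU Uz).
exact: U0.
Qed.

Lemma measurable_supp mu : measurable (supp mu).
Proof. by apply: closed_measurable; exact: supp_closed. Qed.

(** Every point off the support has a null open neighbourhood, hence lies in a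
    null interval with rational endpoints; there are countably many of these. *)
Lemma negligible_suppC mu : mu.-negligible (~` supp mu).
Proof.
(* [I] enumerates the intervals with rational endpoints, and [N] keeps the null
   ones. *)
pose I (k : nat) : set R := if (unpickle k : option (rat * rat)) is Some ab then
    `]ratr ab.1, ratr ab.2[%classic else set0.
pose N k := if `[< mu (I k) = 0%E >] then I k else set0.
apply: (negligibleS _ (negligible_bigcup (mu := mu) (F := N) _)); last first.
  move=> k; rewrite /N; case: asboolP => [I0|_]; last exact: negligible_set0.
  by apply/negligibleP => //; rewrite /I; case: unpickle => [[a b]|].
move=> x /= /existsNP[U /not_implyP[oU /not_implyP[Ux U0]]].
have /nbhs_ballP[e /= e0 xeU] := open_nbhs_nbhs (conj oU Ux).
have xe : x - e < x by rewrite ltrBlDr ltrDl.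
have ex : x < x + e by rewrite ltrDl.
have [a] := rat_in_itvoo xe; have [b] := rat_in_itvoo ex.
rewrite !in_itv/= => /andP[xb be] /andP[ea ax].
exists (pickle (a, b)) => //=; rewrite /N.
have Iab : I (pickle (a, b)) = `]ratr a, ratr b[%classic by rewrite /I pickleK.
case: asboolP => [_|]; first by rewrite Iab /= in_itv/= ax xb.
case; apply/eqP; rewrite Iab eq_le measure_ge0 andbT.
have U0' : (mu U <= 0)%E by rewrite leNgt; exact/negP.
apply: le_trans U0'; apply: le_measure; rewrite ?inE//.
  exact: open_measurable.
move=> z /=; rewrite in_itv/= => /andP[az zb]; apply: xeU.
rewrite /ball/= distrC ltr_distl; apply/andP; split.
  exact: lt_trans az.
exact: lt_trans be.
Qed.

Lemma probability_supset_supp mu {D : set R} :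
  measurable D -> supp mu `<=` D -> mu D = 1%E.
Proof.
move=> mD sD; have mDC : measurable (~` D) by exact: measurableC.
have : mu (~` D) = 0%E.
  apply/negligibleP => //; apply: negligibleS (negligible_suppC mu).
  exact: subsetC.
by rewrite probability_setC// => /eqP; rewrite sube_eq ?add0e// => /eqP.
Qed.

(** The other points of the support form a closed set, whose complement is an
    open neighbourhood of y meeting the support only at y. *)
Lemma finite_supp_atom mu y : finite_set (supp mu) -> supp mu y ->
  (0 < mu [set y])%E.
Proof.
move=> fS Sy.
have oU : open (~` (supp mu `\ y)).
  rewrite openC; apply: finite_closed; exact: finite_setD.
have : (0 < mu (~` (supp mu `\ y)))%E by apply: Sy => //= -[_ /(_ erefl)].
move=> /lt_le_trans; apply.
have mSC : measurable (~` supp mu).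
  by apply: measurableC; exact: measurable_supp.
have S0 : mu (~` supp mu) = 0%E.
  by apply/negligibleP => //; exact: negligible_suppC.
rewrite -[leRHS]adde0 -[X in (_ <= _ + X)%E]S0.
apply: (@le_trans _ _ (mu ([set y] `|` ~` supp mu))); last exact: measureU2.
apply: le_measure; rewrite ?inE; first exact: open_measurable.
  exact: measurableU.
move=> z /= h; have [->|/eqP zy] := eqVneq z y; [by left|right => Sz].
by apply: h.
Qed.

End support.

(** * Integrals and weighted continuous functions *)

Section integrals.
Context {R : realType}.
Implicit Types (mu : probability R R) (p : \bar R) (D Y : set R) (f g : R -> R).

Lemma le_integral_shift mu D f g (c : R) :
  measurable D -> mu D = 1%E ->
  mu.-integrable D (EFin \o f) -> mu.-integrable D (EFin \o g) ->
  (forall x, D x -> f x <= g x + c) ->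
  (\int[mu]_(x in D) (f x)%:E <= \int[mu]_(x in D) (g x)%:E + c%:E)%E.
Proof.
move=> mD muD fi gi fg.
have ci := finite_measure_integrable_cst mu c mD.
have -> : (c%:E = \int[mu]_(x in D) (EFin \o cst c) x)%E.
  apply/esym/(etrans (integral_cst mu mD c%:E)).
  by rewrite -[RHS]mule1; congr (_ * _)%E.
rewrite -integralD//; apply: le_integral => //; first exact: integrableD.
by move=> x; rewrite inE => Dx; rewrite /= lee_fin fg.
Qed.

Lemma C0_bounded_by p D f (M : R) : {within D, continuous f} ->
  (forall x, D x -> `|f x| <= M * weight p x) -> C0 p D f.
Proof. by move=> cf fM; split => //; apply/C0norm_lty; exists M. Qed.

(** The integrability of the weight makes every element of [C0 p (supp m)]
    integrable.  The domination of |x| by the weight, which is where 1 <= p is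
    used, lets functions of linear growth belong to this space.  For p = +oo
    the weight is 1, and the domination says that the support is bounded. *)
Lemma finite_moment_weight p mu : (1 <= p)%E -> finite_moment p mu ->
  mu.-integrable (supp mu) (EFin \o weight p) /\
  exists2 C, 0 <= C & forall x, supp mu x -> `|x| <= C * weight p x.
Proof.
have mS := measurable_supp mu.
case: p => [p| |]//; rewrite ?lee_fin => p1; rewrite /finite_moment/= => fin.
  have p0 : 0 < p by exact: lt_le_trans p1.
  split; last first.
    exists 1 => // x _; rewrite mul1r.
    have [x1|x1] := leP `|x| 1; first by rewrite (le_trans x1)// lerDl powR_ge0.
    rewrite -[leLHS]powRr1//.
    by rewrite (le_trans (ler_powR (ltW x1) p1))// lerDr.
  apply: (@integrableS _ _ _ mu setT) => //.
  apply: (@integrableD _ _ _ mu setT measurableT (EFin \o cst 1)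
    (fun x => (`|x| `^ p)%:E)); first exact: finite_measure_integrable_cst.
  have m : measurable_fun setT (fun x : R => `|x| `^ p).
    exact: (measurableT_comp (measurable_powR p)).
  apply/integrableP; split; first exact/measurable_EFinP.
  under eq_integral do rewrite /= ger0_norm ?powR_ge0//.
  rewrite ltey; apply/eqP => intoo; move: fin.
  by rewrite intoo poweRyr// gt_eqF ?invr_gt0.
split; first exact: (@finite_measure_integrable_cst _ _ _ mu _ 1).
have ub x : supp mu x -> (`|x|%:E <= ereal_sup [set `|x|%:E | x in supp mu])%E.
  by move=> Sx; apply: ereal_sup_ubound; exists x.
case: (ereal_sup _) fin ub => [C _ ub|//|_ ub].
  exists `|C| => // x Sx; rewrite mulr1 (le_trans _ (ler_norm C))//.
  by rewrite -lee_fin ub.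
by exists 0 => // x /ub.
Qed.

Lemma C0_integrable p mu f : mu.-integrable (supp mu) (EFin \o weight p) ->
  C0 p (supp mu) f -> mu.-integrable (supp mu) (EFin \o f).
Proof.
have mS := measurable_supp mu.
move=> wi [cf /C0norm_lty[M fM]].
have Mwi := integrableZl mS M wi.
apply: le_integrable Mwi => //.
  by apply/measurable_EFinP; exact: subspace_continuous_measurable_fun.
move=> x Sx /=; rewrite lee_fin (le_trans (fM _ Sx))//.
exact: ler_norm.
Qed.

(** A finite subset of the line is discrete. *)
Lemma finite_within_continuous Y f : finite_set Y -> {within Y, continuous f}.
Proof.
move=> fY; apply/subspace_continuousP => x Yx U /nbhs_singleton Ufx.
have oV : open (~` (Y `\ x)).
  by rewrite openC; apply: finite_closed; exact: finite_setD.
have Vx : (~` (Y `\ x)) x by move=> [_ /(_ erefl)].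
apply: (filterS _ (open_nbhs_nbhs (conj oV Vx))) => z Vz Yz /=.
have [->//|/eqP zx] := eqVneq z x.
by exfalso; apply: Vz.
Qed.

Lemma finite_C0 p Y f : finite_set Y -> C0 p Y f.
Proof.
move=> fY; have [s Ys] := (finite_seqP Y).1 fY.
apply: (@C0_bounded_by _ _ _ (\sum_(y <- s) `|f y| / weight p y)).
  exact: finite_within_continuous.
move=> x; rewrite Ys/= => xs; rewrite -ler_pdivrMr ?weight_gt0//.
rewrite (big_rem x)//= lerDl sumr_ge0// => y _.
by rewrite divr_ge0// ltW// weight_gt0.
Qed.

Lemma finite_integrable mu Y f : finite_set Y ->
  mu.-integrable Y (EFin \o f).
Proof.
move=> fY; have mY : measurable Y.
  by apply: closed_measurable; exact: finite_closed.
have [_ /C0norm_lty[M fM]] := @finite_C0 +oo%E _ f fY.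
apply: le_integrable (finite_measure_integrable_cst mu M mY) => //.
  apply/measurable_EFinP; apply: subspace_continuous_measurable_fun => //.
  exact: finite_within_continuous.
move=> x Yx /=; rewrite lee_fin; apply: le_trans (ler_norm _).
by have := fM x Yx; rewrite mulr1.
Qed.

End integrals.

(** * Conjugates over a finite set, and a minimisation principle *)

Section finite_conjugate.
Context {R : realType} (Y : set R).
Hypotheses (fY : finite_set Y) (Y0 : Y !=set0).
Implicit Types (f g h : R -> R) (p : \bar R).

Lemma finite_argmax h : exists2 y, Y y & forall z, Y z -> h z <= h y.
Proof.
have [s Ys] := (finite_seqP Y).1 fY.
have [y0] := Y0; rewrite Ys /=; case: s {Ys} => // y1 s _.
elim: s y1 => [y1|y2 s ih y1].
  by exists y1 => [|z] /=; rewrite inE// => /eqP ->.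
have [y /= ys ymax] := ih y2; have [yy1|y1y] := leP (h y) (h y1).
  exists y1 => [|z] /=; first by rewrite inE eqxx.
  by rewrite inE => /predU1P[->//|zs]; exact: le_trans (ymax _ zs) yy1.
exists y => [|z] /=; first by rewrite inE ys orbT.
by rewrite inE => /predU1P[->|/ymax//]; exact: ltW.
Qed.

Definition rconjugate g x : R := fine (conjugate Y g x).

Lemma conjugate_attained g x :
  exists2 y, Y y & conjugate Y g x = (x * y - g y)%:E.
Proof.
have [y Yy ymax] := finite_argmax (fun y => x * y - g y).
exists y => //; apply/eqP; rewrite eq_le; apply/andP; split.
  by apply: ge_ereal_sup => _ [z Yz <-]; rewrite lee_fin ymax.
by apply: ereal_sup_ubound; exists y.
Qed.

Lemma rconjugateE g x : (rconjugate g x)%:E = conjugate Y g x.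
Proof. by rewrite /rconjugate; have [y _ ->] := conjugate_attained g x. Qed.

Lemma rconjugate_ge g x y : Y y -> x * y - g y <= rconjugate g x.
Proof.
by move=> Yy; rewrite -lee_fin rconjugateE; apply: ereal_sup_ubound; exists y.
Qed.

Lemma rconjugate_le g x (c : R) :
  (forall y, Y y -> x * y - g y <= c) -> rconjugate g x <= c.
Proof.
move=> gc; rewrite -lee_fin rconjugateE.
by have [y Yy ->] := conjugate_attained g x; rewrite lee_fin gc.
Qed.

Lemma rconjugate_shift g h (c : R) x : (forall y, Y y -> g y <= h y + c) ->
  rconjugate h x <= rconjugate g x + c.
Proof.
move=> gh; apply: rconjugate_le => y Yy.
by have := rconjugate_ge g x y Yy; have := gh y Yy; lra.
Qed.

Lemma finite_norm_bounded : exists2 L, 0 <= L & forall y, Y y -> `|y| <= L.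
Proof.
have [y Yy ymax] := finite_argmax Num.norm.
by exists `|y|.
Qed.

(** A conjugate is a maximum of affine functions with slopes in Y. *)
Lemma rconjugate_lipschitz : exists2 L, 0 <= L &
  forall g x z, rconjugate g x <= rconjugate g z + L * `|x - z|.
Proof.
have [L L0 YL] := finite_norm_bounded; exists L => // g x z.
apply: rconjugate_le => y Yy; have := rconjugate_ge g z y Yy.
suff : (x - z) * y <= L * `|x - z| by lra.
by rewrite (le_trans (ler_norm _))// normrM mulrC ler_wpM2r// YL.
Qed.

Lemma rconjugate_continuous g : continuous (rconjugate g).
Proof.
have [L L0 lip] := rconjugate_lipschitz.
move=> x; apply/cvgrPdist_lt => e e0.
have d0 : 0 < e / (L + 1) by rewrite divr_gt0// ltr_wpDl.
have /cvgrPdist_lt/(_ _ d0) : z @[z --> x] --> x by exact: cvg_id.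
apply: filterS => z; rewrite ltr_pdivlMr ?ltr_wpDl// => xz.
have le1 := lip g x z; have := lip g z x; rewrite (distrC z x) => le2.
have := normr_ge0 (x - z); rewrite ltr_distl => ?.
by apply/andP; split; lra.
Qed.

Lemma rconjugate_C0 p (D : set R) g :
  (exists2 C, 0 <= C & forall x, D x -> `|x| <= C * weight p x) ->
  C0 p D (rconjugate g).
Proof.
move=> [C C0 DC]; have [L L0 lip] := rconjugate_lipschitz.
apply: (@C0_bounded_by _ _ _ _ (`|rconjugate g 0| + L * C)).
  by apply: continuous_subspaceT => x; exact: rconjugate_continuous.
move=> x Dx.
have w1 : 1 <= weight p x by case: p {DC} => [p||]//=; rewrite lerDl powR_ge0.
have le1 := lip g x 0; have := lip g 0 x; rewrite (distrC 0) subr0 in le1 *.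
have LC : L * `|x| <= L * C * weight p x by rewrite -mulrA ler_wpM2l// DC.
have n0 : `|rconjugate g 0| <= `|rconjugate g 0| * weight p x.
  by rewrite ler_peMr.
have := ler_norm (rconjugate g 0); have := ler_norm (- rconjugate g 0).
rewrite normrN mulrDl ler_norml => ? ? ?; apply/andP; split; lra.
Qed.

(** The first hypothesis packages three properties of F: F g depends only on the
    restriction of g to Y (c = d = 0), F is continuous for the sup norm on Y
    (c = d), and F is invariant under the addition of constants (d = -c).  The
    second is coercivity on nonnegative functions vanishing somewhere on Y, to
    which invariance reduces the problem.  The functions of this kind with
    F g <= F 0 thus lie in a box, with one bound per point of Y. *)
Lemma finite_coercive_attained (F : (R -> R) -> R) :
  (forall g h (c d : R), (forall y, Y y -> g y <= h y + c) ->
    (forall y, Y y -> h y <= g y + d) -> F g <= F h + (c + d)) ->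
  (forall y, Y y -> exists M, forall g, (forall z, Y z -> 0 <= g z) ->
    (exists2 z, Y z & g z = 0) -> F g <= F (cst 0) -> g y <= M) ->
  exists u, forall g, F u <= F g.
Proof.
move=> Fshift Fcoercive.
have /choice[M FM] : forall y, exists M : R, Y y -> forall g,
    (forall z, Y z -> 0 <= g z) -> (exists2 z, Y z & g z = 0) ->
    F g <= F (cst 0) -> g y <= M.
  move=> y; have [Yy|nYy] := pselect (Y y); last by exists 0.
  by have [M ?] := Fcoercive y Yy; exists M.
(* All coordinates are kept, with F ignoring those off Y, so that the box is a
   product over the whole line and needs no indexing of Y. *)
pose T : topologicalType := prod_topology (fun _ : R => R).
pose B : set T := [set f | forall y, `[0, `|M y|]%classic (f y)].
have cB : compact B.
  apply: (@tychonoff R (fun=> R) (fun y => `[0, `|M y|]%classic)) => y.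
  exact: segment_compact.
have B0 : B !=set0 by exists (fun=> 0) => y /=; rewrite in_itv/= lexx normr_ge0.
have cF : continuous (F : T -> R).
  move=> f; apply/(@cvgrPdist_lt R R T (nbhs f)) => e e0.
  have [s Ys] := (finite_seqP Y).1 fY.
  (* F moves by at most twice the perturbation, hence thirds rather than halves
     to keep the estimate strict. *)
  have e3 : 0 < e / 3 by rewrite divr_gt0.
  have : \forall h \near f, forall y, y \in s ->
      `|(f : R -> R) y - (h : R -> R) y| < e / 3.
    elim: (s) => [|y t ih]; first by apply: filterE => h y; rewrite in_nil.
    have /(@cvgrPdist_lt R R T (nbhs f))/(_ _ e3) :=
      @proj_continuous R (fun=> R) y f.
    apply: filterS2 ih => h ih hy z.
    by rewrite inE => /predU1P[->//|]; exact: ih.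
  apply: filterS => h fh.
  have {}fh y : Y y -> `|(f : R -> R) y - (h : R -> R) y| < e / 3.
    by rewrite Ys; exact: fh.
  have le1 : F f <= F h + (e / 3 + e / 3).
    by apply: Fshift => y /fh; rewrite ltr_distl => /andP[? ?]; lra.
  have le2 : F h <= F f + (e / 3 + e / 3).
    by apply: Fshift => y /fh; rewrite ltr_distl => /andP[? ?]; lra.
  by rewrite ltr_distl; apply/andP; split; lra.
have [u _ umin] : exists2 u : T, u \in B & forall g : T, g \in B -> F u <= F g.
  by apply: compact_EVT_min => //; exact: continuous_subspaceT.
exists u => g.
(* Subtract from g its minimum on Y, attained at y0, and reset it to 0 off Y to
   land in the box. *)
have [y0 Yy0 y0min] := finite_argmax (fun y => - g y).
pose h y := if y \in Y then g y - g y0 else 0.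
have hE y : Y y -> h y = g y - g y0 by move=> Yy; rewrite /h mem_set.
have h0 z : Y z -> 0 <= h z.
  by move=> Yz; have := y0min z Yz; rewrite hE//; lra.
have hg : F h <= F g.
  have -> : F g = F g + (- g y0 + g y0) by rewrite addNr addr0.
  by apply: Fshift => y Yy; rewrite hE//; lra.
have [h00|/ltW h00] := leP (F h) (F (cst 0)).
  apply: le_trans hg; apply: umin; rewrite inE => y /=; rewrite in_itv/=.
  have [Yy|nYy] := pselect (Y y); last by rewrite /h memNset// lexx normr_ge0.
  rewrite h0//= (le_trans _ (ler_norm _))// FM//.
  by exists y0 => //; rewrite hE// subrr.
apply: le_trans hg; apply: le_trans h00; apply: umin.
by rewrite inE => y /=; rewrite in_itv/= lexx normr_ge0.
Qed.

End finite_conjugate.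

(** * The functional Jtilde *)

Section functional.
Context {R : realType} (p : \bar R) (m : probability R R).
Context (A : set (probability R R)).
Hypotheses (p1 : (1 <= p)%E) (mp : finite_moment p m).
Hypotheses (A0 : A !=set0) (fY : finite_set (supports A)).
Implicit Types (f g h : R -> R).

Let Y := supports A.
Let X := supp m.

Let wi : m.-integrable X (EFin \o weight p).
Proof. by have [] := finite_moment_weight p m p1 mp. Qed.

Let mX : measurable X. Proof. exact: measurable_supp. Qed.

Let mY : measurable Y.
Proof. by apply: closed_measurable; exact: finite_closed. Qed.

Let muX : m X = 1%E. Proof. exact: probability_supset_supp. Qed.

Let muY r : A r -> r Y = 1%E.
Proof.
by move=> Ar; apply: probability_supset_supp => //; exact: bigcup_sup.
Qed.

Let Y0 : Y !=set0.
Proof.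
have [r Ar] := A0; apply/set0P/eqP => YE.
have := muY r Ar; rewrite YE measure0 => /eqP; rewrite eq_sym.
by rewrite onee_eq0.
Qed.

Let conj_C0 g : C0 p X (rconjugate Y g).
Proof.
by apply: rconjugate_C0 => //; have [] := finite_moment_weight p m p1 mp.
Qed.

Let conj_integrable g : m.-integrable X (EFin \o rconjugate Y g).
Proof. exact: (C0_integrable p m _ wi (conj_C0 g)). Qed.

Lemma sigma_shift g h (c : R) : (forall y, Y y -> g y <= h y + c) ->
  (sigma A g <= sigma A h + c%:E)%E.
Proof.
move=> gh; apply: ge_ereal_sup => _ [r Ar <-].
apply: le_trans (le_integral_shift r Y g h c mY _ _ _ gh) _.
- exact: muY.
- exact: finite_integrable.
- exact: finite_integrable.
by rewrite leeD2r//; apply: ereal_sup_ubound; exists r.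
Qed.

(** Finiteness follows from sigma(0) = 0 and [sigma_shift], comparing g with 0
    in both directions. *)
Lemma sigma_fin_num g : sigma A g \is a fin_num.
Proof.
have s0 : sigma A (cst 0%R) = 0%E.
  rewrite /sigma (_ : [set _ | _ in _] = [set 0%E]) ?ereal_sup1//.
  apply/seteqP; split => [_ [r _ <-]|_ ->] /=; first by rewrite integral0.
  by have [r Ar] := A0; exists r => //; rewrite integral0.
have [y Yy ymax] := finite_argmax Y fY Y0 (fun y => `|g y|).
have le1 : (sigma A g <= sigma A (cst 0%R) + `|g y|%:E)%E.
  apply: sigma_shift => z Yz; rewrite add0r.
  exact: le_trans (ler_norm _) (ymax z Yz).
have : (sigma A (cst 0%R) <= sigma A g + `|g y|%:E)%E.
  apply: sigma_shift => z Yz.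
  have := ymax z Yz; rewrite ler_norml => /andP[? _].
  by rewrite /=; lra.
by move: le1; rewrite s0; case: (sigma A g).
Qed.

Lemma JtildeE g :
  Jtilde m A g = (\int[m]_(x in X) (rconjugate Y g x)%:E + sigma A g)%E.
Proof.
rewrite /Jtilde; congr (_ + _)%E; apply: eq_integral => x _.
by rewrite rconjugateE.
Qed.

Lemma Jtilde_fin_num g : Jtilde m A g \is a fin_num.
Proof.
rewrite JtildeE fin_numD sigma_fin_num andbT.
exact: (integrable_fin_num mX (conj_integrable g)).
Qed.

(** A bound g <= h + c controls sigma, and the reverse bound h <= g + d controls
    the conjugates, since conjugation reverses the order. *)
Lemma Jtilde_shift g h (c d : R) : (forall y, Y y -> g y <= h y + c) ->
  (forall y, Y y -> h y <= g y + d) ->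
  (Jtilde m A g <= Jtilde m A h + (c + d)%:E)%E.
Proof.
move=> gh hg; rewrite !JtildeE EFinD [in leRHS](addeC c%:E) addeACA.
apply: leeD; last exact: sigma_shift.
apply: le_integral_shift => // x _; exact: rconjugate_shift.
Qed.

(** If g(y) = 0, then g^*(x) >= x y >= - L |x|, where L bounds Y; the right-hand
    side is bounded below by an integrable multiple of the weight, independent
    of g and y. *)
Lemma conjugate_integral_lbound : exists W : R, forall g y, Y y -> g y = 0 ->
  (W%:E <= \int[m]_(x in X) (rconjugate Y g x)%:E)%E.
Proof.
have [_ [C C0 XC]] := finite_moment_weight p m p1 mp.
have [L L0 YL] := finite_norm_bounded Y fY Y0.
have Li := integrableZl mX (- (C * L)) wi.
exists (fine (\int[m]_(x in X) ((- (C * L))%:E * (EFin \o weight p) x))%E).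
move=> g y Yy gy0; rewrite fineK; last exact: (integrable_fin_num mX Li).
apply: le_integral => //; first exact: conj_integrable.
move=> x; rewrite inE => Xx /=.
rewrite -EFinM lee_fin; apply: le_trans (rconjugate_ge Y fY Y0 g x y Yy).
rewrite gy0 subr0 mulNr lerNl.
rewrite (le_trans (ler_norm _))// normrN normrM -mulrA (mulrC L) mulrA.
by rewrite ler_pM// ?XC ?YL.
Qed.

(** The constant d is the mass r{y}, for a measure r in A with y in its
    support. *)
Lemma sigma_ge_atom y : Y y -> exists2 d : R, 0 < d & forall g,
  (forall z, Y z -> 0 <= g z) -> ((d * g y)%:E <= sigma A g)%E.
Proof.
move=> Yy; have [r Ar ry] := Yy.
have rY : supp r `<=` Y by exact: bigcup_sup.
have d0 : (0 < r [set y])%E.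
  by apply: finite_supp_atom => //; exact: sub_finite_set fY.
have dfin : r [set y] \is a fin_num by exact: fin_num_measure.
exists (fine (r [set y])); first by rewrite -lte_fin fineK.
move=> g g0.
apply: (@le_trans _ _ (\int[r]_(z in Y) (g z)%:E)%E); last first.
  by apply: ereal_sup_ubound; exists r.
apply: (@le_trans _ _ (\int[r]_(z in [set y]) (g z)%:E)%E); last first.
  apply: ge0_subset_integral => //.
  - by have /integrableP[] := finite_integrable r Y g fY.
  - by move=> z ->.
rewrite (eq_integral (cst (g y)%:E)); last by move=> z; rewrite inE/= => ->.
by rewrite integral_cst// EFinM fineK// muleC.
Qed.

Lemma Jtilde_attained : exists u, forall g, (Jtilde m A u <= Jtilde m A g)%E.
Proof.
have [] := @finite_coercive_attained R Y fY Y0 (fun g => fine (Jtilde m A g)).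
- move=> g h c d gh hg; rewrite -lee_fin EFinD !fineK ?Jtilde_fin_num//.
  exact: Jtilde_shift.
- move=> y Yy; have [W intW] := conjugate_integral_lbound.
  have [d d0 sigmad] := sigma_ge_atom y Yy.
  exists ((fine (Jtilde m A (cst 0)) - W) / d) => g g0 [z Yz gz0].
  rewrite ler_pdivlMr// lerBrDr mulrC addrC; apply: le_trans.
  rewrite -lee_fin fineK ?Jtilde_fin_num// JtildeE EFinD.
  by apply: leeD; [exact: intW gz0|exact: sigmad].
move=> u umin; exists u => g.
rewrite -[leLHS]fineK ?Jtilde_fin_num// -[leRHS]fineK ?Jtilde_fin_num//.
by rewrite lee_fin.
Qed.

Lemma Jtilde_le_J q fg : K p q X Y fg -> (Jtilde m A fg.2 <= J m A fg)%E.
Proof.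
case: fg => f g [/= fC0 _ fgK]; rewrite JtildeE /J leeD2r//=.
apply: le_integral => //; [exact: conj_integrable|exact: C0_integrable fC0|].
move=> x; rewrite inE => Xx; rewrite lee_fin.
by apply: rconjugate_le => // y Yy; have := fgK x y Xx Yy; lra.
Qed.

Lemma rconjugate_K q g : K p q X Y (rconjugate Y g, g).
Proof.
split => /=; [exact: conj_C0|exact: finite_C0|move=> x y _ Yy].
by have := rconjugate_ge Y fY Y0 g x y Yy; lra.
Qed.

End functional.

(** * Existence of minimisers *)

Lemma lbound_inf_attained {R : realType} {T : Type} (S : set T)
    (F : T -> \bar R) u :
  S u -> (forall v, S v -> (F u <= F v)%E) -> inf_attained S F.
Proof.
move=> Su umin; exists u => //; apply/eqP; rewrite eq_le; apply/andP; split.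
  by apply: le_ereal_inf_tmp => _ [v Sv <-]; exact: umin.
by apply: ereal_inf_lbound; exists u.
Qed.

Theorem theorem5p5 (R : realType) (p q : \bar R)
  (m : probability R R) (A : set (probability R R)) :
  (1 <= p)%E ->
  (p^-1 + q^-1 = 1)%E ->
  finite_moment p m ->
  A `<=` finite_moment q ->
  A !=set0 ->
  (ereal_sup [set moment q r | r in A] < +oo)%E ->
  convex_measures A ->
  weak_star_closed q A ->
  supports A `<=` [set y | 0 <= y] ->
  finite_set (supports A) ->
  inf_attained (K p q (supp m) (supports A)) (J m A) /\
  inf_attained (C0 q (supports A)) (Jtilde m A).
Proof.
move=> p1 _ mp _ A0 _ _ _ _ fY.
have [u umin] := Jtilde_attained p m A p1 mp A0 fY.
split; last first.
  apply: (lbound_inf_attained _ _ u); first exact: finite_C0.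
  by move=> g _; exact: umin.
apply: (lbound_inf_attained _ _ (rconjugate (supports A) u, u)).
  exact: rconjugate_K.
move=> fg Kfg; apply: le_trans (Jtilde_le_J _ _ _ p1 mp A0 fY _ _ Kfg).
by rewrite /J/= -JtildeE.
Qed.
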